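(* Let $F_1,\dots,F_k$ be $d\times d$ positive semidefinite matrices with $\sum_{j=1}^k F_j\preceq\mathbb{I}$, and let $\lambda\in\mathbb{R}^k$. Let $\xi=\exp(\lambda\cdot F)/\operatorname{tr}\exp(\lambda\cdot F)$, let $P=\sum_{j}\operatorname{tr}(F_j\xi)\,|j\rangle\langle j|$ be the $k\times k$ diagonal matrix of mean values, and let $L$ be the $k\times k$ Hessian matrix of the function $\lambda\mapsto\ln\operatorname{tr}\exp(\lambda\cdot F)$ at $\lambda$. Then $L\preceq P$.
   Context: $\lambda\cdot F=\sum_j\lambda_jF_j$. $A\preceq B$ means $B-A$ is positive semidefinite. *)

(* Defs.v *)
From HB Require Import structures.
From mathcomp Require Import all_boot all_order all_algebra.
From mathcomp Require Import all_classical all_reals all_analysis.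
From mathcomp Require Import complex.
Set Implicit Arguments. Unset Strict Implicit. Unset Printing Implicit Defensive.
Import Order.TTheory GRing.Theory Num.Theory.
Import numFieldNormedType.Exports.
Local Open Scope ring_scope.

Definition adjmx (R : rcfType) m n (A : 'M[complex R]_(m, n)) : 'M[complex R]_(n, m) :=
  \matrix_(i, j) conjc (A j i).

(* Positive semidefinite (Hermitian, nonnegative quadratic form).
   The order on complex R is the canonical partial order: z >= 0 iff z is real nonneg. *)
Definition psdmx (R : rcfType) d (A : 'M[complex R]_d) : Prop :=
  adjmx A = A /\ forall v : 'cV[complex R]_d, 0 <= (adjmx v *m A *m v) 0 0.

Definition loewner_le (R : rcfType) d (A B : 'M[complex R]_d) : Prop := psdmx (B - A).

Definition rC (R : rcfType) (x : R) : complex R := Complex x 0.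

Definition expmx_partial (R : rcfType) d (A : 'M[complex R]_d) (N : nat) : 'M[complex R]_d :=
  \sum_(n < N) (n`!%:R)^-1 *: A ^+ n.

(* Matrix exponential: the (entrywise, via real and imaginary parts) limit of the
   exponential series, which always converges. *)
Definition expmx (R : realType) d (A : 'M[complex R]_d) : 'M[complex R]_d :=
  \matrix_(i, j) Complex (limn (fun N => complex.Re (expmx_partial A N i j)))
                         (limn (fun N => complex.Im (expmx_partial A N i j))).

Definition lincomb (R : rcfType) d k (F : 'I_k -> 'M[complex R]_d) (lam : 'rV[R]_k)
  : 'M[complex R]_d := \sum_(j < k) rC (lam 0 j) *: F j.

(* The log-partition function  lambda |-> ln tr exp(lambda . F)  (the trace is real). *)
Definition logZ (R : realType) d k (F : 'I_k -> 'M[complex R]_d) (lam : 'rV[R]_k) : R :=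
  ln (complex.Re (\tr (expmx (lincomb F lam)))).

Definition gibbs (R : realType) d k (F : 'I_k -> 'M[complex R]_d) (lam : 'rV[R]_k)
  : 'M[complex R]_d :=
  (\tr (expmx (lincomb F lam)))^-1 *: expmx (lincomb F lam).

Definition meanmx (R : realType) d k (F : 'I_k -> 'M[complex R]_d) (lam : 'rV[R]_k)
  : 'M[complex R]_k :=
  \matrix_(i, j) if i == j then \tr (F i *m gibbs F lam) else 0.

Definition evec (R : realType) k (i : 'I_k) : 'rV[R]_k := delta_mx 0 i.

Definition hessian_logZ (R : realType) d k (F : 'I_k -> 'M[complex R]_d) (lam : 'rV[R]_k)
  : 'M[R]_k :=
  \matrix_(i, j) derive (fun mu => derive (logZ F) mu (@evec R k j)) lam (@evec R k i).

(* Main.v *)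
(* Diagonalise A = lambda . F as A = U^-1 diag(a) U with U unitary, and let
   Z = tr exp A.  Since
   ||(A + tB)^n - A^n - t sum_m A^m B A^(n-1-m)|| <= C t^2 (3c)^n, the
   exponential series may be differentiated termwise, so the Hessian is
   L_ij = K_ij / Z - m_i m_j with m_i = tr(F_i exp A) / Z and
   K_ij = sum_pq e[a_p, a_q] (U F_i U^-1)_pq (U F_j U^-1)_qp, where e[x, y] is
   the divided difference of exp.  For real x put X = sum_j x_j F_j.  Dropping
   the rank-one term, x^T L x <= K(X, X) / Z; the bound
   e[x, y] <= (e^x + e^y) / 2 gives K(X, X) <= tr(X^2 exp A); and
   X^2 <= sum_j x_j^2 F_j because sum_j F_j <= 1. *)
Require Import Defs.
From HB Require Import structures.
From mathcomp Require Import all_boot all_order all_algebra.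
From mathcomp Require Import all_classical all_reals all_analysis.
From mathcomp Require Import complex.
From mathcomp Require Import ring lra.
Import Order.TTheory GRing.Theory Num.Theory.
Import numFieldNormedType.Exports Normc.
Local Open Scope ring_scope.
Set Implicit Arguments.
Unset Strict Implicit.

(** * Real scalars inside the complex numbers *)

HB.instance Definition _ (R : rcfType) :=
  GRing.RMorphism.copy (@rC R) (real_complex R).

Lemma conjc_rC (R : rcfType) (x : R) : conjc (rC x) = rC x.
Proof. exact: conjc_real. Qed.

Lemma Re_rCM (R : rcfType) (x : R) (z : complex R) :
  complex.Re (rC x * z) = x * complex.Re z.
Proof. by case: z => a b /=; rewrite mul0r subr0. Qed.

Lemma Im_rCM (R : rcfType) (x : R) (z : complex R) :
  complex.Im (rC x * z) = x * complex.Im z.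
Proof. by case: z => a b /=; rewrite mul0r addr0. Qed.

Lemma Re_sum (R : rcfType) (I : finType) (f : I -> complex R) :
  complex.Re (\sum_i f i) = \sum_i complex.Re (f i).
Proof. by elim/big_rec2: _ => // i y [a b] _ /= <-; case: (f i). Qed.

Lemma Im_sum (R : rcfType) (I : finType) (f : I -> complex R) :
  complex.Im (\sum_i f i) = \sum_i complex.Im (f i).
Proof. by elim/big_rec2: _ => // i y [a b] _ /= <-; case: (f i). Qed.

Lemma rC_Re (R : rcfType) (z : complex R) : conjc z = z -> rC (complex.Re z) = z.
Proof. by case: z => a b [] hb; congr Complex; lra. Qed.

(** * Adjoints and the Loewner order *)

Section Adjoint.
Variable R : rcfType.
Implicit Types m n p : nat.

Lemma adjmxE m n (A : 'M[complex R]_(m, n)) : adjmx A = map_mx conjc A^T.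
Proof. by apply/matrixP=> i j; rewrite !mxE. Qed.

Lemma adjmxM m n p (A : 'M[complex R]_(m, n)) (B : 'M[complex R]_(n, p)) :
  adjmx (A *m B) = adjmx B *m adjmx A.
Proof. by rewrite !adjmxE trmx_mul map_mxM. Qed.

Lemma adjmxK m n (A : 'M[complex R]_(m, n)) : adjmx (adjmx A) = A.
Proof. by apply/matrixP=> i j; rewrite !mxE conjcK. Qed.

Lemma adjmxD m n (A B : 'M[complex R]_(m, n)) : adjmx (A + B) = adjmx A + adjmx B.
Proof. by rewrite !adjmxE linearD map_mxD. Qed.

Lemma adjmxN m n (A : 'M[complex R]_(m, n)) : adjmx (- A) = - adjmx A.
Proof. by rewrite !adjmxE linearN map_mxN. Qed.

Lemma adjmxZ m n (x : R) (A : 'M[complex R]_(m, n)) :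
  adjmx (rC x *: A) = rC x *: adjmx A.
Proof. by rewrite !adjmxE linearZ map_mxZ; congr (_ *: _); exact: conjc_rC. Qed.

Lemma adjmx_sum m n (I : finType) (A : I -> 'M[complex R]_(m, n)) :
  adjmx (\sum_i A i) = \sum_i adjmx (A i).
Proof.
by rewrite adjmxE !raddf_sum; apply: eq_bigr => i _; rewrite adjmxE.
Qed.

Lemma adjmx1 n : adjmx 1%:M = 1%:M :> 'M[complex R]_n.
Proof. by rewrite adjmxE trmx1 map_mx1. Qed.

Lemma psdmx0 n : psdmx (0 : 'M[complex R]_n).
Proof.
split=> [|v]; last by rewrite mulmx0 mul0mx mxE.
by apply/matrixP=> i j; rewrite !mxE conjc0.
Qed.

Lemma psdmxD n (A B : 'M[complex R]_n) : psdmx A -> psdmx B -> psdmx (A + B).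
Proof.
move=> [hA pA] [hB pB]; split=> [|v]; first by rewrite adjmxD hA hB.
by rewrite mulmxDr mulmxDl mxE addr_ge0.
Qed.

Lemma psdmx_sum n (I : finType) (A : I -> 'M[complex R]_n) :
  (forall i, psdmx (A i)) -> psdmx (\sum_i A i).
Proof.
move=> pA; elim/big_rec: _ => [|i B _ pB]; first exact: psdmx0.
exact: psdmxD.
Qed.

Lemma psdmx_conj m n (A : 'M[complex R]_m) (B : 'M[complex R]_(m, n)) :
  psdmx A -> psdmx (adjmx B *m A *m B).
Proof.
move=> [hA pA]; split=> [|v]; first by rewrite !adjmxM hA adjmxK mulmxA.
by have := pA (B *m v); rewrite adjmxM !mulmxA.
Qed.

Lemma psdmx_diag n (A : 'M[complex R]_n) i : psdmx A -> 0 <= A i i.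
Proof.
move=> [_ /(_ (delta_mx i 0))].
have -> : adjmx (delta_mx i 0) = delta_mx 0 i :> 'M[complex R]_(1, n).
  by rewrite adjmxE trmx_delta map_delta_mx.
by rewrite -rowE -colE !mxE.
Qed.

(** The spectral theorem for normal matrices; a Hermitian matrix has real spectrum, so the
    eigenvalues can be stored in [R]. *)
Lemma hermitian_diagonalization n (A : 'M[complex R]_n) : adjmx A = A ->
  exists (U : 'M[complex R]_n) (a : 'I_n -> R),
    [/\ U *m adjmx U = 1%:M, adjmx U *m U = 1%:M &
        A = adjmx U *m diag_mx (\row_i rC (a i)) *m U].
Proof.
move=> hA.
have adjE m p (B : 'M[complex R]_(m, p)) : adjmx B = map_mx Num.conj B^T.
  exact: adjmxE.
have herm : A \is hermitianmx _ false Num.conj.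
  by apply/is_hermitianmxP; rewrite expr0 scale1r -adjE hA.
have [U [s [Uu AE sr]]] : exists (U : 'M[complex R]_n) (s : 'rV[complex R]_n),
    [/\ U \is unitarymx, A = invmx U *m diag_mx s *m U &
        forall i, s 0 i \is Num.real].
  exists (spectralmx A), (spectral_diag A); split.
  - exact: spectral_unitarymx.
  - by have /orthomx_spectralP := hermitian_normalmx herm.
  - by have /mxOverP sr := hermitian_spectral_diag_real herm; move=> i; apply: sr.
have UU : U *m adjmx U = 1%:M by rewrite adjE; apply/unitarymxP.
have UA : invmx U = adjmx U by rewrite adjE invmx_unitary.
exists U, (fun i => complex.Re (s 0 i)); split.
- exact: UU.
- exact: mulmx1C UU.
- rewrite [LHS]AE UA; congr (_ *m diag_mx _ *m _).
  by apply/rowP=> i; rewrite mxE; apply/esym/RRe_real.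
Qed.

(* Expand [\sum_j (x_j - X) F_j (x_j - X) + X (1 - \sum_j F_j) X >= 0],
   where [X = \sum_j x_j F_j]. *)
Lemma sqr_sum_loewner d k (F : 'I_k -> 'M[complex R]_d) (x : 'I_k -> R) :
  (forall j, psdmx (F j)) -> loewner_le (\sum_j F j) 1%:M ->
  let X := \sum_j rC (x j) *: F j in
  loewner_le (X *m X) (\sum_j rC (x j ^+ 2) *: F j).
Proof.
move=> pF pS X; rewrite /loewner_le.
have hX : adjmx X = X.
  by rewrite adjmx_sum; apply: eq_bigr => j _; rewrite adjmxZ (pF j).1.
have pY j : psdmx ((rC (x j) *: 1%:M - X) *m F j *m (rC (x j) *: 1%:M - X)).
  have := psdmx_conj (rC (x j) *: 1%:M - X) (pF j).
  by rewrite adjmxD adjmxN adjmxZ adjmx1 hX.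
have := psdmxD (psdmx_sum pY) (psdmx_conj X pS).
rewrite hX; congr psdmx.
have -> : \sum_i (rC (x i) *: 1%:M - X) *m F i *m (rC (x i) *: 1%:M - X) =
  \sum_i (rC (x i ^+ 2) *: F i) - X *m X - X *m X + X *m (\sum_j F j) *m X.
  under eq_bigr do rewrite mulmxBl mulmxBr !mulmxBl -!scalemxAl -!scalemxAr
    !mul1mx !mulmx1 scalerA -expr2 -rmorphXn.
  rewrite !sumrB opprB addrA.
  have -> : \sum_i rC (x i) *: (F i *m X) = X *m X.
    by rewrite {2}/X mulmx_suml; apply: eq_bigr => j _; rewrite scalemxAl.
  have -> : \sum_i rC (x i) *: (X *m F i) = X *m X.
    by rewrite {3}/X mulmx_sumr; apply: eq_bigr => j _; rewrite scalemxAr.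
  by rewrite [X *m (\sum_j F j)]mulmx_sumr mulmx_suml addrAC.
rewrite mulmxBr mulmxBl mulmx1.
by rewrite -addrA [X in _ + X]addrC subrK subrK.
Qed.

(** For [v = u + i w], symmetry cancels the cross terms of the Hermitian form and leaves the real
    form at [u] plus the real form at [w]. *)
Lemma psdmx_map_rC k (M : 'M[R]_k) : M^T = M ->
  (forall x : 'I_k -> R, 0 <= \sum_i \sum_j x i * x j * M i j) ->
  psdmx (map_mx (@rC R) M).
Proof.
move=> hM pM; have sM i j : M i j = M j i by rewrite -[in LHS]hM mxE.
split=> [|v]; first by apply/matrixP=> i j; rewrite !mxE conjc_rC sM.
have -> : (adjmx v *m map_mx (@rC R) M *m v) 0 0 =
    \sum_i \sum_j conjc (v i 0) * v j 0 * rC (M i j).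
  rewrite mxE exchange_big; apply: eq_bigr => j _.
  rewrite mxE mulr_suml; apply: eq_bigr => i _.
  by rewrite !mxE mulrAC.
set S := \sum_i _.
have Sc : conjc S = S.
  rewrite /S [RHS]exchange_big raddf_sum; apply: eq_bigr => i _ /=.
  rewrite raddf_sum; apply: eq_bigr => j _ /=.
  by rewrite !rmorphM /= oppr0 conjcK -/(rC _) sM [v i 0 * _]mulrC.
rewrite -(rC_Re Sc) ler0c /S Re_sum.
have -> : \sum_i complex.Re (\sum_j conjc (v i 0) * v j 0 * rC (M i j)) =
  \sum_i \sum_j complex.Re (v i 0) * complex.Re (v j 0) * M i j +
  \sum_i \sum_j complex.Im (v i 0) * complex.Im (v j 0) * M i j.
  rewrite -big_split; apply: eq_bigr => i _; rewrite -big_split Re_sum.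
  apply: eq_bigr => j _; rewrite mulrC Re_rCM /=.
  by case: (v i 0) (v j 0) => [a b] [c e] /=; rewrite mulNr opprK mulrC mulrDl.
by rewrite addr_ge0.
Qed.

End Adjoint.

(** * Derivatives from quadratic remainders, and finite sums of limits *)

(** Dividing the bound by [|t|] puts the difference quotient within [K |t|] of [l]. *)
Lemma is_derive_quadratic (R : realType) (V : normedModType R) (f : V -> R)
    (a v : V) (l K : R) :
  (forall t : R, `|t| <= 1 -> `|f (t *: v + a) - f a - t * l| <= K * t ^+ 2) ->
  is_derive a v f l.
Proof.
move=> fK.
have K0 : 0 <= K.
  by have := fK 1; rewrite normr1 expr1n mulr1 => /(_ (lexx _)); apply: le_trans.
have cv : ((fun h : R => h^-1 *: (f (h *: v + a) - f a)) @ 0^' --> l)%classic.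
  apply/cvgrPdist_le => e e0; near=> h.
  have h0 : h != 0 by near: h; exact: nbhs_dnbhs_neq.
  have hpos : 0 < `|h| by rewrite normr_gt0.
  have h1 : `|h| <= 1.
    by near: h; apply: dnbhs0_le.
  (* [K + 1] keeps the denominator positive when [K = 0]. *)
  have he : `|h| <= e / (K + 1).
    by near: h; apply: dnbhs0_le; rewrite divr_gt0 // ltr_wpDl.
  rewrite -(ler_pM2l hpos) -normrM mulrBr.
  rewrite -[h^-1 *: _]/(h^-1 * _) mulVKf // distrC.
  apply: (le_trans (fK h h1)).
  rewrite -real_normK ?num_real // expr2 mulrCA ler_pM2l //.
  apply: (@le_trans _ _ ((K + 1) * `|h|)); first by rewrite ler_pM2r // lerDl.
  by rewrite mulrC -ler_pdivlMr // ltr_wpDl.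
apply: DeriveDef; first by apply/cvg_ex; exists l; exact: cv.
exact: cvg_lim cv.
Unshelve. all: by end_near. Qed.

Lemma cvg_sum_fin (R : realType) (I : finType) (u : nat -> I -> R) (l : I -> R) :
  (forall i, ((fun N => u N i) @ \oo --> l i)%classic) ->
  ((fun N => \sum_i u N i) @ \oo --> \sum_i l i)%classic.
Proof.
by move=> ul; apply: cvg_big => [|i _]; [exact: add_continuous | exact: ul].
Qed.

(** * Divided differences of the exponential *)

Section ExpDividedDifference.
Variable R : realType.
Implicit Types x y : R.

(** The divided difference of [z^n], that is the sum of [x^m y^(n-1-m)] over [m < n]. The recursive
    form covers [x = y] and matches the recursion for derivatives of matrix powers. *)
Fixpoint pow_divdiff x y n : R :=
  if n is n'.+1 then x * pow_divdiff x y n' + y ^+ n' else 0.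

Lemma pow_divdiffE x y n : (x - y) * pow_divdiff x y n = x ^+ n - y ^+ n.
Proof.
elim: n => [|n IH]; first by rewrite /= mulr0 !expr0 subrr.
by rewrite /= mulrDr mulrCA IH !exprS; ring.
Qed.

Lemma pow_divdiff_diag x n : pow_divdiff x x n = n%:R * x ^+ n.-1.
Proof.
elim: n => [|[|n] IH] /=; first by rewrite mul0r.
  by rewrite mulr0 add0r mul1r.
by move: IH => /= ->; rewrite exprS -[n.+2%:R]natr1; ring.
Qed.

Definition exp_divdiff x y : R :=
  if x == y then expR x else (expR x - expR y) / (x - y).

Lemma exp_divdiffC x y : exp_divdiff x y = exp_divdiff y x.
Proof.
rewrite /exp_divdiff eq_sym; case: eqP => [->//|_].
by rewrite -(opprB y) -(opprB (expR y)) invrN mulrNN.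
Qed.

Lemma exp_divdiffxx x : exp_divdiff x x = expR x.
Proof. by rewrite /exp_divdiff eqxx. Qed.

Lemma cvg_expR_sum x :
  ((fun N => \sum_(n < N) (n`!%:R)^-1 * x ^+ n) @ \oo --> expR x)%classic.
Proof.
have -> : (fun N => \sum_(n < N) (n`!%:R)^-1 * x ^+ n) = series (exp_coeff x).
  apply/funext => N; rewrite /series /= big_mkord.
  by apply: eq_bigr => i _; rewrite mulrC.
exact: is_cvg_series_exp_coeff.
Qed.

(** Off the diagonal, the partial sums are difference quotients of those of the exponential. On the
    diagonal, [n x^(n-1) / n! = x^(n-1) / (n-1)!], so the exponential series reappears, shifted by
    one. *)
Lemma cvg_exp_divdiff x y :
  ((fun N => \sum_(n < N) (n`!%:R)^-1 * pow_divdiff x y n) @ \oo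
    --> exp_divdiff x y)%classic.
Proof.
rewrite /exp_divdiff; case: eqP => [<-|/eqP xy].
  rewrite -(cvg_shiftS _ (nbhs (expR x))).
  have -> : (fun N => \sum_(n < N.+1) (n`!%:R)^-1 * pow_divdiff x x n) =
            (fun N => \sum_(n < N) (n`!%:R)^-1 * x ^+ n).
    apply/funext => N; rewrite big_ord_recl [pow_divdiff _ _ _]/= mulr0 add0r.
    apply: eq_bigr => i _; rewrite pow_divdiff_diag.
    rewrite /= /bump add1n mulrA; congr (_ * _).
    by rewrite factS natrM invfM mulrAC mulVf ?mul1r // pnatr_eq0.
  exact: cvg_expR_sum.
have d0 : x - y != 0 by rewrite subr_eq0.
have -> : (fun N => \sum_(n < N) (n`!%:R)^-1 * pow_divdiff x y n) =
  (fun N => (\sum_(n < N) (n`!%:R)^-1 * x ^+ n -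
             \sum_(n < N) (n`!%:R)^-1 * y ^+ n) / (x - y)).
  apply/funext => N; rewrite -sumrB mulr_suml; apply: eq_bigr => n _.
  by rewrite -mulrBr -pow_divdiffE -mulrA mulrAC divff // mul1r.
by apply: cvgMr_tmp; apply: cvgB; exact: cvg_expR_sum.
Qed.

(* The function [(w - 2) e^w + w + 2] vanishes at [0] and has derivative
   [(w - 1) e^w + 1 >= 0]. *)
Lemma expR_tanh_bound (w : R) : 0 <= w -> 2 * (expR w - 1) <= w * (expR w + 1).
Proof.
move=> w0.
pose f t : R := (t - 2) * expR t + t.
pose df t : R := (t - 2) * expR t + expR t + 1.
have fd (t : R) : is_derive t (1 : R) f (df t).
  rewrite /f; apply: is_derive_eq; rewrite /df /GRing.scale /=; ring.
have [|c cw] := @MVT_segment R f df 0 w w0.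
  by apply: derivable_within_continuous => t _; exact: ex_derive.
rewrite /f /df expR0 => e.
(* Multiplied by [e^c] this gives [df c >= 0], hence [f w >= f 0 = 0]. *)
have c1 : 1 - c <= expR (- c) by have := expR_ge1Dx (- c).
have : (1 - c) * expR c <= 1.
  by have := ler_wpM2r (expR_ge0 c) c1; rewrite [expR (- c) * _]mulrC expRxMexpNx_1.
nra.
Qed.

(** The divided difference is the mean of [exp] between [x] and [y], which convexity puts below the
    trapezoid value. Concretely, this is [expR_tanh_bound] at [w = x - y], multiplied by [e^y]. *)
Lemma exp_divdiff_le x y : exp_divdiff x y <= (expR x + expR y) / 2.
Proof.
wlog yx : x y / y <= x => [H|].
  by case/orP: (le_total y x) => /H //; rewrite exp_divdiffC [expR y + _]addrC.
rewrite /exp_divdiff; case: eqP => [->|/eqP xy]; first lra.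
have d0 : 0 < x - y by rewrite subr_gt0 lt_neqAle eq_sym xy.
rewrite ler_pdivrMr //.
have := ler_wpM2l (expR_ge0 y) (expR_tanh_bound (ltW d0)).
have -> : expR x = expR y * expR (x - y) by rewrite -expRD addrC subrK.
nra.
Qed.

End ExpDividedDifference.

(** * The exponential of a diagonalised matrix *)

Definition unitary_diag (R : rcfType) d (U : 'M[complex R]_d) (a : 'I_d -> R)
    (A : 'M[complex R]_d) : Prop :=
  [/\ U *m adjmx U = 1%:M, adjmx U *m U = 1%:M &
      A = adjmx U *m diag_mx (\row_i rC (a i)) *m U].

(* The derivative of [t |-> (A + t B)^n] at [0], that is
   [\sum_(m < n) A^m B A^(n - 1 - m)]. *)
Fixpoint pow_deriv (R : rcfType) d (A B : 'M[complex R]_d) n : 'M[complex R]_d :=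
  if n is n'.+1 then A *m pow_deriv A B n' + B *m A ^+ n' else 0.

Section Diagonal.
Variables (R : realType) (d : nat).
Variables (U : 'M[complex R]_d) (a : 'I_d -> R) (A : 'M[complex R]_d).
Hypothesis UaA : unitary_diag U a A.
Implicit Types (B G M : 'M[complex R]_d) (s : 'I_d -> R).

Let rot B := U *m B *m adjmx U.

Lemma unitary_diag_mulmx M (N : 'M[complex R]_d) :
  (adjmx U *m M *m U) *m (adjmx U *m N *m U) = adjmx U *m (M *m N) *m U.
Proof. by have [UU _ _] := UaA; rewrite -!mulmxA (mulmxA U) UU mul1mx. Qed.

Lemma unitary_diagK B : adjmx U *m rot B *m U = B.
Proof.
have [_ UU _] := UaA.
by rewrite /rot !mulmxA UU mul1mx -mulmxA UU mulmx1.
Qed.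

Lemma unitary_diag_exp n :
  A ^+ n = adjmx U *m diag_mx (\row_i rC (a i ^+ n)) *m U.
Proof.
have [_ UU AE] := UaA; elim: n => [|n IH].
  have -> : diag_mx (\row_i rC (a i ^+ 0)) = 1%:M :> 'M[complex R]_d.
    rewrite -diag_const_mx; congr diag_mx; apply/rowP=> i; rewrite !mxE.
    by rewrite expr0.
  by rewrite mulmx1 UU expr0.
rewrite exprS IH [X in X * _]AE -mulmxE unitary_diag_mulmx mulmx_diag.
set D := \row_j (_ * _); have -> // : D = \row_i rC (a i ^+ n.+1).
by apply/rowP=> i; rewrite !mxE exprS rmorphM.
Qed.

(** In the eigenbasis, [A] on the left scales entry [(p, q)] by [a_p] and [A^n] on the right scales
    it by [a_q^n], so the recursion of [pow_deriv] becomes that of [pow_divdiff] in each entry. *)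
Lemma unitary_diag_pow_deriv B n : pow_deriv A B n =
  adjmx U *m (\matrix_(p, q) (rC (pow_divdiff (a p) (a q) n) * rot B p q)) *m U.
Proof.
elim: n => [|n IH].
  rewrite [_ A B 0]/=; set M := \matrix_(_, _) _.
  have -> : M = 0 by apply/matrixP=> i j; rewrite !mxE rmorph0 mul0r.
  by rewrite mulmx0 mul0mx.
rewrite [pow_deriv _ _ _.+1]/= IH unitary_diag_exp.
rewrite -[X in _ + X *m _](unitary_diagK B).
have [_ _ AE] := UaA; rewrite [X in X *m _ + _]AE.
rewrite !unitary_diag_mulmx -mulmxDl -mulmxDr; congr (_ *m _ *m _).
apply/matrixP=> p q; rewrite mul_diag_mx mul_mx_diag !mxE.
by rewrite rmorphD rmorphM mulrDl mulrA (mulrC (rC (a q ^+ n))).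
Qed.

Lemma Re_tr_unitary_diag s G :
  complex.Re (\tr (adjmx U *m diag_mx (\row_i rC (s i)) *m U *m G)) =
  \sum_p s p * complex.Re (rot G p p).
Proof.
rewrite -!mulmxA mxtrace_mulC -mulmxA /mxtrace Re_sum.
by apply: eq_bigr => p _; rewrite mul_diag_mx 2!mxE Re_rCM.
Qed.

Lemma Re_tr_rot M G :
  complex.Re (\tr (adjmx U *m M *m U *m G)) =
  \sum_p \sum_q complex.Re (M p q * rot G q p).
Proof.
rewrite -!mulmxA mxtrace_mulC -mulmxA /mxtrace Re_sum.
by apply: eq_bigr => p _; rewrite mxE Re_sum.
Qed.

Lemma expmx_partial_unitary_diag N : expmx_partial A N =
  adjmx U *m diag_mx (\row_i rC (\sum_(n < N) (n`!%:R)^-1 * a i ^+ n)) *m U.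
Proof.
rewrite /expmx_partial.
under eq_bigr do rewrite unitary_diag_exp scalemxAl scalemxAr.
rewrite -mulmx_suml -mulmx_sumr; congr (_ *m _ *m _).
apply/matrixP=> i j; rewrite summxE !mxE rmorph_sum -sumrMnl.
apply: eq_bigr => n _; rewrite !mxE rmorphM fmorphV rmorph_nat.
by rewrite mulrnAr.
Qed.

(** [f] stands for the real or the imaginary part. Real linearity makes the value a finite real
    combination of the [s N p]. *)
Lemma cvg_unitary_diag_entry (s : nat -> 'I_d -> R) (l : 'I_d -> R)
    (f : complex R -> R) i j :
  (forall x z, f (rC x * z) = x * f z) ->
  (forall (g : 'I_d -> complex R), f (\sum_p g p) = \sum_p f (g p)) ->
  (forall p, ((fun N => s N p) @ \oo --> l p)%classic) ->
  ((fun N => f ((adjmx U *m diag_mx (\row_p rC (s N p)) *m U) i j)) @ \oo -->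
    f ((adjmx U *m diag_mx (\row_p rC (l p)) *m U) i j))%classic.
Proof.
move=> fZ fD sl.
have E t : f ((adjmx U *m diag_mx (\row_p rC (t p)) *m U) i j) =
    \sum_p t p * f (adjmx U i p * U p j).
  rewrite mxE fD; apply: eq_bigr => p _.
  by rewrite mul_mx_diag [X in f (X * _)]mxE [X in _ * X * _]mxE mulrAC mulrC fZ.
rewrite E; under eq_fun do rewrite E.
by apply: cvg_sum_fin => p; apply: cvgMr_tmp; exact: sl.
Qed.

Lemma expmx_unitary_diag :
  expmx A = adjmx U *m diag_mx (\row_i rC (expR (a i))) *m U.
Proof.
apply/matrixP=> i j; rewrite mxE.
have limE (f : complex R -> R) : (forall x z, f (rC x * z) = x * f z) ->
    (forall g : 'I_d -> complex R, f (\sum_p g p) = \sum_p f (g p)) ->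
    limn (fun N => f (expmx_partial A N i j)) =
    f ((adjmx U *m diag_mx (\row_i rC (expR (a i))) *m U) i j).
  move=> fZ fD; apply: cvg_lim => //.
  under eq_fun do rewrite expmx_partial_unitary_diag.
  by apply: cvg_unitary_diag_entry => // p; exact: cvg_expR_sum.
rewrite (limE _ (@Re_rCM R) (@Re_sum R _)) (limE _ (@Im_rCM R) (@Im_sum R _)).
by case: (_ i j).
Qed.

Lemma Re_tr_expmx G : complex.Re (\tr (expmx A *m G)) =
  \sum_p expR (a p) * complex.Re (rot G p p).
Proof. by rewrite expmx_unitary_diag Re_tr_unitary_diag. Qed.

Lemma cvg_Re_tr_expmx_partial G :
  ((fun N => \sum_(n < N) (n`!%:R)^-1 * complex.Re (\tr (A ^+ n *m G))) @ \oo -->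
    complex.Re (\tr (expmx A *m G)))%classic.
Proof.
rewrite Re_tr_expmx.
have -> : (fun N => \sum_(n < N) (n`!%:R)^-1 * complex.Re (\tr (A ^+ n *m G))) =
  (fun N => \sum_p (\sum_(n < N) (n`!%:R)^-1 * a p ^+ n) * complex.Re (rot G p p)).
  apply/funext => N; under [RHS]eq_bigr do rewrite mulr_suml.
  rewrite exchange_big; apply: eq_bigr => n _.
  rewrite unitary_diag_exp Re_tr_unitary_diag mulr_sumr.
  by apply: eq_bigr => p _; rewrite mulrA.
by apply: cvg_sum_fin => p; apply: cvgMr_tmp; exact: cvg_expR_sum.
Qed.

(** For Hermitian [A] and [B], the derivative at [t = 0] of [Re tr(exp(A + t B) G)] in
    Daleckii-Krein form; as a form in [B] and [G] it is an unnormalised Kubo-Mori product. *)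
Definition exp_deriv_tr B G : R := \sum_p \sum_q
  exp_divdiff (a p) (a q) * complex.Re (rot B p q * rot G q p).

Lemma cvg_exp_deriv_tr B G :
  ((fun N => \sum_(n < N) (n`!%:R)^-1 * complex.Re (\tr (pow_deriv A B n *m G)))
    @ \oo --> exp_deriv_tr B G)%classic.
Proof.
have -> : (fun N => \sum_(n < N) (n`!%:R)^-1 *
                     complex.Re (\tr (pow_deriv A B n *m G))) =
  (fun N => \sum_p \sum_q (\sum_(n < N) (n`!%:R)^-1 *
     pow_divdiff (a p) (a q) n) * complex.Re (rot B p q * rot G q p)).
  apply/funext => N.
  under [RHS]eq_bigr do under eq_bigr do rewrite mulr_suml.
  under [RHS]eq_bigr do rewrite exchange_big.
  rewrite exchange_big; apply: eq_bigr => n _.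
  rewrite unitary_diag_pow_deriv Re_tr_rot mulr_sumr.
  apply: eq_bigr => p _; rewrite mulr_sumr; apply: eq_bigr => q _.
  by rewrite mxE -[RHS]mulrA; congr (_ * _); rewrite -mulrA Re_rCM.
apply: cvg_sum_fin => p; apply: cvg_sum_fin => q; apply: cvgMr_tmp.
exact: cvg_exp_divdiff.
Qed.

(** The identity is unchanged in the eigenbasis, so only [p = q] contributes, where the divided
    difference is [e^(a_p)]. *)
Lemma exp_deriv_tr1 B : exp_deriv_tr B 1%:M = complex.Re (\tr (expmx A *m B)).
Proof.
have [UU _ _] := UaA.
rewrite Re_tr_expmx; apply: eq_bigr => p _; rewrite (bigD1 p) //= big1 => [|q qp].
  by rewrite addr0 exp_divdiffxx /rot mulmx1 UU [1%:M _ _]mxE eqxx mulr1.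
by rewrite /rot mulmx1 UU [1%:M _ _]mxE (negPf qp) mulr0 mulr0.
Qed.

End Diagonal.

(** The algebra of one induction step for powers: [P], [Q], [D] will be [A^n], [(A + x B)^n] and
    [pow_deriv A B n]. *)
Lemma mulmx_remainder (K : comNzRingType) d (A B P D Q : 'M[K]_d) (x : K) :
  (A + x *: B) *m Q - A *m P - x *: (A *m D + B *m P) =
  (A + x *: B) *m (Q - P - x *: D) + (x ^+ 2) *: (B *m D).
Proof.
rewrite !mulmxBr !mulmxDl -!scalemxAl -!scalemxAr scalerA -expr2.
by rewrite scalerDr !opprD !addrA subrK addrAC.
Qed.

(** * Termwise differentiation of the exponential series *)

Lemma mxtrace_mulmx_lin (K : comNzRingType) d (X Y D G : 'M[K]_d) (z : K) :
  \tr ((X - Y - z *: D) *m G) = \tr (X *m G) - \tr (Y *m G) - z * \tr (D *m G).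
Proof. by rewrite !mulmxBl -scalemxAl !linearB linearZ. Qed.

Lemma Re_sub (R : rcfType) (x y : complex R) :
  complex.Re (x - y) = complex.Re x - complex.Re y.
Proof. by case: x y => [a b] [c e]. Qed.

(** * An entrywise norm and second-order remainders of powers *)

Section EntrywiseNorm.
Variables (R : realType) (d : nat).
Implicit Types A B : 'M[complex R]_d.

(** This norm is submultiplicative and dominates the modulus of the trace. The identity has norm
    [d], whence the factor [mxnorm1 1%:M] in the bounds on powers. *)
Definition mxnorm1 A : R := \sum_i \sum_j normc (A i j).

Lemma normc_ge0 (z : complex R) : 0 <= normc z.
Proof. by case: z => x y; rewrite /= sqrtr_ge0. Qed.

Lemma normc_sum (I : finType) (f : I -> complex R) :
  normc (\sum_i f i) <= \sum_i normc (f i).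
Proof.
elim/big_rec2: _ => [|i y z _ IH]; first by rewrite normc0.
by apply: le_trans (le_normcD _ _) _; rewrite lerD2l.
Qed.

Lemma Re_le_normc (z : complex R) : `|complex.Re z| <= normc z.
Proof. by have := normc_ge_Re z; rewrite lecR. Qed.

Lemma mxnorm1_ge0 A : 0 <= mxnorm1 A.
Proof. by apply: sumr_ge0 => i _; apply: sumr_ge0 => j _; exact: normc_ge0. Qed.

Lemma mxnorm10 : mxnorm1 0 = 0.
Proof.
by rewrite /mxnorm1 big1 // => i _; rewrite big1 // => j _; rewrite mxE normc0.
Qed.

Lemma mxnorm1D A B : mxnorm1 (A + B) <= mxnorm1 A + mxnorm1 B.
Proof.
rewrite /mxnorm1 -big_split; apply: ler_sum => i _.
rewrite -big_split; apply: ler_sum => j _; rewrite mxE; exact: le_normcD.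
Qed.

Lemma mxnorm1Z (t : R) A : mxnorm1 (rC t *: A) = `|t| * mxnorm1 A.
Proof.
rewrite /mxnorm1 mulr_sumr; apply: eq_bigr => i _.
rewrite mulr_sumr; apply: eq_bigr => j _; rewrite mxE normcM /=.
by rewrite expr0n /= addr0 sqrtr_sqr.
Qed.

Lemma mxnorm1M A B : mxnorm1 (A *m B) <= mxnorm1 A * mxnorm1 B.
Proof.
rewrite /mxnorm1 mulr_suml; apply: ler_sum => i _.
apply: (@le_trans _ _ (\sum_k \sum_j normc (A i j) * normc (B j k))).
  apply: ler_sum => k _; rewrite mxE; apply: le_trans (normc_sum _) _.
  by apply: ler_sum => j _; rewrite normcM.
rewrite exchange_big mulr_suml; apply: ler_sum => j _; rewrite -mulr_sumr.
rewrite ler_wpM2l ?normc_ge0 //.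
rewrite [leRHS](bigD1 j) //= lerDl.
by apply: sumr_ge0 => l _; apply: sumr_ge0 => m _; exact: normc_ge0.
Qed.

Lemma normc_tr A : normc (\tr A) <= mxnorm1 A.
Proof.
apply: le_trans (normc_sum _) _; apply: ler_sum => i _.
by rewrite (bigD1 i) //= lerDl sumr_ge0 // => j _; exact: normc_ge0.
Qed.

Lemma mxnorm1_exp A (c : R) n : mxnorm1 A <= c ->
  mxnorm1 (A ^+ n) <= mxnorm1 1%:M * c ^+ n.
Proof.
move=> Ac; elim: n => [|n IH]; first by rewrite !expr0 mulr1.
rewrite exprS -mulmxE; apply: le_trans (mxnorm1M _ _) _.
rewrite exprS mulrCA ler_pM ?mxnorm1_ge0 //.
Qed.

(** The recursion has two summands, each at most [c] times the previous bound; the base [2c] absorbs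
    both, so no factor [n] is carried. *)
Lemma mxnorm1_pow_deriv A B (c : R) n : 1 <= c -> mxnorm1 A <= c ->
  mxnorm1 B <= c -> mxnorm1 (pow_deriv A B n) <= mxnorm1 1%:M * (2 * c) ^+ n.
Proof.
move=> c1 Ac Bc; have c0 : 0 <= c by exact: le_trans c1.
have N0 := mxnorm1_ge0 1%:M.
elim: n => [|n IH].
  by rewrite [pow_deriv _ _ _]/= mxnorm10 expr0 mulr1.
apply: le_trans (mxnorm1D _ _) _; rewrite exprS mulrCA -mulrA mulr2n mulrDl mul1r.
rewrite lerD //; apply: le_trans (mxnorm1M _ _) _; rewrite ler_pM ?mxnorm1_ge0 //.
apply: le_trans (mxnorm1_exp n Ac) _.
rewrite ler_wpM2l // lerXn2r ?nnegrE ?mulr_ge0 //.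
by rewrite ler_peMl // lerDl.
Qed.

Definition pow_rem A B (t : R) n : 'M[complex R]_d :=
  (A + rC t *: B) ^+ n - A ^+ n - rC t *: pow_deriv A B n.

Lemma pow_remS A B t n : pow_rem A B t n.+1 =
  (A + rC t *: B) *m pow_rem A B t n + rC (t ^+ 2) *: (B *m pow_deriv A B n).
Proof.
rewrite /pow_rem ![_ ^+ n.+1]exprS -!mulmxE [pow_deriv _ _ _.+1]/= rmorphXn.
exact: mulmx_remainder.
Qed.

(** Of [3c], the part [2c] bounds the norm of [A + t B]; the other [c] accounts for [t^2 B] times
    [pow_deriv A B n], whose growth [(2c)^n] is at most [(3c)^n]. *)
Lemma mxnorm1_pow_rem A B (c t : R) n : 1 <= c -> mxnorm1 A <= c ->
  mxnorm1 B <= c -> `|t| <= 1 ->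
  mxnorm1 (pow_rem A B t n) <= t ^+ 2 * mxnorm1 1%:M * (3 * c) ^+ n.
Proof.
move=> c1 Ac Bc t1; have c0 : 0 <= c by exact: le_trans c1.
have N0 := mxnorm1_ge0 1%:M.
elim: n => [|n IH].
  rewrite /pow_rem !expr0 subrr scaler0 subr0 mxnorm10.
  by rewrite mulr1 mulr_ge0 // sqr_ge0.
rewrite pow_remS [_ ^+ n.+1]exprS.
apply: (@le_trans _ _ ((2 * c) * (t ^+ 2 * mxnorm1 1%:M * (3 * c) ^+ n) +
    t ^+ 2 * (c * (mxnorm1 1%:M * (3 * c) ^+ n)))); last first.
  by rewrite le_eqVlt; apply/orP; left; apply/eqP; ring.
apply: le_trans (mxnorm1D _ _) _; rewrite lerD //.
  apply: le_trans (mxnorm1M _ _) _; rewrite ler_pM ?mxnorm1_ge0 //.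
  apply: le_trans (mxnorm1D _ _) _; rewrite mxnorm1Z mulr2n mulrDl mul1r lerD //.
  by apply: le_trans Bc; rewrite ler_piMl // mxnorm1_ge0.
rewrite mxnorm1Z ger0_norm ?sqr_ge0 // ler_wpM2l ?sqr_ge0 //.
apply: le_trans (mxnorm1M _ _) _; rewrite ler_pM ?mxnorm1_ge0 //.
apply: le_trans (mxnorm1_pow_deriv n c1 Ac Bc) _; rewrite ler_wpM2l //.
by rewrite lerXn2r ?nnegrE ?mulr_ge0 // ler_wpM2r // ler_nat.
Qed.

End EntrywiseNorm.

(** The power remainders, weighted by [1 / n!], sum to the quantity on the left, and their bounds
    sum to [t^2] times a multiple of [exp(3c)] independent of [t]. *)
Lemma Re_tr_expmx_remainder (R : realType) d (A B G U : 'M[complex R]_d)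
    (a : 'I_d -> R) :
  unitary_diag U a A -> adjmx A = A -> adjmx B = B ->
  exists K, forall t : R, `|t| <= 1 ->
    `|complex.Re (\tr (expmx (A + rC t *: B) *m G)) -
      complex.Re (\tr (expmx A *m G)) - t * exp_deriv_tr U a B G| <= K * t ^+ 2.
Proof.
move=> UaA hA hB.
(* One constant, at least [1], that bounds both norms. *)
pose c := 1 + mxnorm1 A + mxnorm1 B.
have [A0 B0] := (mxnorm1_ge0 A, mxnorm1_ge0 B).
have c1 : 1 <= c by rewrite /c; lra.
have Ac : mxnorm1 A <= c by rewrite /c; lra.
have Bc : mxnorm1 B <= c by rewrite /c; lra.
exists (mxnorm1 (1%:M : 'M[complex R]_d) * expR (3 * c) * mxnorm1 G) => t t1.
have hAB : adjmx (A + rC t *: B) = A + rC t *: B by rewrite adjmxD adjmxZ hA hB.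
(* [A + t B] has its own eigenbasis, used for the convergence of its exponential series. *)
have [V [b VbAB]] := hermitian_diagonalization hAB.
pose phi M : R := complex.Re (\tr (M *m G)).
have cvL : ((fun N => \sum_(n < N) (n`!%:R)^-1 * phi (pow_rem A B t n)) @ \oo -->
    phi (expmx (A + rC t *: B)) - phi (expmx A) - t * exp_deriv_tr U a B G)%classic.
  have -> : (fun N => \sum_(n < N) (n`!%:R)^-1 * phi (pow_rem A B t n)) =
    (fun N => \sum_(n < N) (n`!%:R)^-1 * phi ((A + rC t *: B) ^+ n) -
              \sum_(n < N) (n`!%:R)^-1 * phi (A ^+ n) -
              t * \sum_(n < N) (n`!%:R)^-1 * phi (pow_deriv A B n)).
    apply/funext => N; rewrite mulr_sumr -!sumrB; apply: eq_bigr => n _.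
    have -> : phi (pow_rem A B t n) = phi ((A + rC t *: B) ^+ n) - phi (A ^+ n) -
        t * phi (pow_deriv A B n).
      by rewrite /phi [X in complex.Re X = _]mxtrace_mulmx_lin !Re_sub Re_rCM.
    by rewrite !mulrBr [t * (_ * _)]mulrCA.
  apply: cvgB; last by apply: cvgMl_tmp; exact: cvg_exp_deriv_tr.
  apply: cvgB; [exact: (cvg_Re_tr_expmx_partial VbAB)|].
  exact: (cvg_Re_tr_expmx_partial UaA).
pose k := t ^+ 2 * mxnorm1 (1%:M : 'M[complex R]_d) * mxnorm1 G.
have cvR : ((fun N => k * \sum_(n < N) (n`!%:R)^-1 * (3 * c) ^+ n) @ \oo -->
    k * expR (3 * c))%classic.
  by apply: cvgMl_tmp; exact: cvg_expR_sum.
rewrite [leRHS](_ : _ = k * expR (3 * c)); last by rewrite /k; ring.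
apply: (ler_cvg_to (cvg_norm cvL) cvR); near=> N.
rewrite mulr_sumr; apply: le_trans (ler_norm_sum _ _ _) _.
apply: ler_sum => n _.
rewrite normrM [`|_^-1|]ger0_norm ?invr_ge0 // [leRHS]mulrCA.
rewrite ler_wpM2l ?invr_ge0 //.
apply: le_trans (Re_le_normc _) _; apply: le_trans (normc_tr _) _.
apply: le_trans (mxnorm1M _ _) _; rewrite [leRHS]mulrAC.
by rewrite ler_wpM2r ?mxnorm1_ge0 //; apply: mxnorm1_pow_rem.
Unshelve. all: by end_near. Qed.

(** * The Hessian of the log-partition function *)

Section KuboMori.
Variables (R : realType) (d : nat).
Variables (U : 'M[complex R]_d) (a : 'I_d -> R) (A : 'M[complex R]_d).
Hypothesis UaA : unitary_diag U a A.
Implicit Types B G X P : 'M[complex R]_d.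

Let K := exp_deriv_tr U a.

Lemma exp_deriv_trC B G : K B G = K G B.
Proof.
rewrite /K /exp_deriv_tr exchange_big; apply: eq_bigr => p _.
by apply: eq_bigr => q _; rewrite exp_divdiffC [X in complex.Re X]mulrC.
Qed.

Lemma exp_deriv_tr_suml (I : finType) (x : I -> R) (B : I -> 'M[complex R]_d) G :
  K (\sum_i rC (x i) *: B i) G = \sum_i x i * K (B i) G.
Proof.
rewrite /K /exp_deriv_tr; under [RHS]eq_bigr do rewrite mulr_sumr.
rewrite [RHS]exchange_big; apply: eq_bigr => p _.
under [RHS]eq_bigr do rewrite mulr_sumr.
rewrite [RHS]exchange_big; apply: eq_bigr => q _.
rewrite mulmx_sumr mulmx_suml summxE mulr_suml Re_sum mulr_sumr.
apply: eq_bigr => i _; rewrite -scalemxAr -scalemxAl mxE -mulrA Re_rCM.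
by rewrite mulrCA.
Qed.

(** The weights [n p q = |Y_pq|^2] are nonnegative and symmetric. Against them, the bound
    [(e^(a_p) + e^(a_q)) / 2] has the same sum as [e^(a_p)], which is the trace on the right. *)
Lemma exp_deriv_tr_le X : adjmx X = X ->
  K X X <= complex.Re (\tr (expmx A *m (X *m X))).
Proof.
move=> hX; have [_ UU _] := UaA.
pose Y := U *m X *m adjmx U.
have hY p q : Y q p = conjc (Y p q).
  have : adjmx Y = Y by rewrite /Y !adjmxM hX adjmxK mulmxA.
  by move/matrixP/(_ q p); rewrite mxE.
pose n p q := complex.Re (Y p q * Y q p).
have nC p q : n p q = n q p by rewrite /n mulrC.
have n0 p q : 0 <= n p q.
  rewrite /n (hY p q); case: (Y p q) => u v /=.
  by rewrite mulrN opprK addr_ge0 // -expr2 sqr_ge0.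
have -> : complex.Re (\tr (expmx A *m (X *m X))) = \sum_p \sum_q expR (a p) * n p q.
  rewrite (Re_tr_expmx UaA); apply: eq_bigr => p _.
  rewrite -mulr_sumr; congr (_ * _).
  have -> : U *m (X *m X) *m adjmx U = Y *m Y.
    by rewrite /Y -!mulmxA (mulmxA (adjmx U) U) UU mul1mx.
  by rewrite mxE Re_sum.
apply: (@le_trans _ _ (\sum_p \sum_q (expR (a p) + expR (a q)) / 2 * n p q)).
  apply: ler_sum => p _; apply: ler_sum => q _.
  by rewrite ler_wpM2r ?n0 // exp_divdiff_le.
have -> : \sum_p \sum_q (expR (a p) + expR (a q)) / 2 * n p q =
  (\sum_p \sum_q expR (a p) * n p q + \sum_p \sum_q expR (a q) * n p q) / 2.
  rewrite -big_split mulr_suml; apply: eq_bigr => p _.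
  rewrite -big_split mulr_suml; apply: eq_bigr => q _ /=; ring.
have -> : \sum_p \sum_q expR (a q) * n p q = \sum_p \sum_q expR (a p) * n p q.
  rewrite exchange_big; apply: eq_bigr => p _.
  by apply: eq_bigr => q _; rewrite nC.
lra.
Qed.

Lemma Re_tr_expmx_psd_ge0 P : psdmx P -> 0 <= complex.Re (\tr (expmx A *m P)).
Proof.
move=> pP; rewrite (Re_tr_expmx UaA); apply: sumr_ge0 => p _.
rewrite mulr_ge0 ?expR_ge0 //.
have := psdmx_diag p (psdmx_conj (adjmx U) pP); rewrite adjmxK.
by rewrite lecE => /andP[].
Qed.

(** The trace is the sum of the [e^(a_p)], and [0 < d] makes this sum nonempty. *)
Lemma Re_tr_expmx_gt0 : (0 < d)%N -> 0 < complex.Re (\tr (expmx A)).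
Proof.
move=> d0; have [UU _ _] := UaA.
rewrite -[expmx A]mulmx1 (Re_tr_expmx UaA) (bigD1 (Ordinal d0)) //=.
have one p : complex.Re ((U *m 1%:M *m adjmx U) p p) = 1.
  by rewrite mulmx1 UU mxE eqxx.
rewrite one mulr1 ltr_pwDl ?expR_gt0 // sumr_ge0 // => p _.
by rewrite one mulr1 expR_ge0.
Qed.

Lemma expmx_hermitian : adjmx (expmx A) = expmx A.
Proof.
rewrite (expmx_unitary_diag UaA) !adjmxM adjmxK mulmxA; congr (_ *m _ *m _).
apply/matrixP=> i j; rewrite !mxE eq_sym; case: eqP => [->|_].
  by rewrite !mulr1n conjc_rC.
by rewrite !mulr0n conjc0.
Qed.

Lemma tr_expmx_real B : adjmx B = B ->
  \tr (expmx A *m B) = rC (complex.Re (\tr (expmx A *m B))).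
Proof.
move=> hB; apply/esym/rC_Re.
have trJ M : conjc (\tr M) = \tr (adjmx M).
  by rewrite raddf_sum; apply: eq_bigr => i _; rewrite mxE.
by rewrite trJ adjmxM hB expmx_hermitian mxtrace_mulC.
Qed.

End KuboMori.

(** * Differentiating the log-partition function *)

(** Restriction to a line turns a directional derivative into one of a function on [R], to which the
    one-variable chain rule for [ln] applies. *)
Lemma is_derive_line (R : realType) (V : normedModType R) (f : V -> R) (a v : V)
    (l : R) :
  is_derive (0 : R) 1 (fun h : R => f (h *: v + a)) l <-> is_derive a v f l.
Proof.
have E : (fun h : R => h^-1 *: ((f \o shift a) (h *: v) - f a)) =
  (fun h : R => h^-1 *: (((fun h : R => f (h *: v + a)) \o shift 0) (h *: 1) -
     f ((0 : R) *: v + a))).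
  by apply/funext => h /=; rewrite addr0 scale0r add0r [h *: 1]mulr1.
by split=> -[dv vl]; split; move: dv vl; rewrite /derivable /derive E.
Qed.

Section LogPartition.
Variables (R : realType) (d k : nat) (F : 'I_k -> 'M[complex R]_d).
Hypothesis psdF : forall j, psdmx (F j).
Implicit Types (mu : 'rV[R]_k) (G : 'M[complex R]_d).

Let Z mu : R := complex.Re (\tr (expmx (lincomb F mu))).
(** The unnormalised expectation of [G]: division by [Z] gives the Gibbs mean, and [G = 1] gives [Z]
    itself. *)
Let Zof G mu : R := complex.Re (\tr (expmx (lincomb F mu) *m G)).

Lemma lincomb_hermitian mu : adjmx (lincomb F mu) = lincomb F mu.
Proof.
rewrite /lincomb adjmx_sum; apply: eq_bigr => j _.
by rewrite adjmxZ (psdF j).1.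
Qed.

Lemma lincomb_shift (t : R) i mu :
  lincomb F (t *: evec R i + mu) = lincomb F mu + rC t *: F i.
Proof.
rewrite /lincomb addrC [in RHS](bigD1 i) //= (bigD1 i) //=.
rewrite !mxE !eqxx mulr1 addrAC rmorphD scalerDl; congr (_ + _).
by apply: eq_bigr => j ji; rewrite !mxE (negPf ji) mulr0 addr0.
Qed.

Lemma is_derive_Zof U a G mu i : unitary_diag U a (lincomb F mu) ->
  is_derive mu (evec R i) (Zof G) (exp_deriv_tr U a (F i) G).
Proof.
move=> Ua.
have [C HC] := Re_tr_expmx_remainder G Ua (lincomb_hermitian mu) (psdF i).1.
apply: (@is_derive_quadratic _ _ _ _ _ _ C) => t t1.
by rewrite /Zof lincomb_shift; exact: HC.
Qed.

Lemma is_derive_Z mu i : is_derive mu (evec R i) Z (Zof (F i) mu).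
Proof.
have [U [a Ua]] := hermitian_diagonalization (lincomb_hermitian mu).
have := is_derive_Zof 1%:M i Ua; rewrite (exp_deriv_tr1 Ua).
by congr is_derive; apply/funext => nu; rewrite /Zof mulmx1.
Qed.

Hypothesis d_gt0 : (0 < d)%N.

Lemma Z_gt0 mu : 0 < Z mu.
Proof.
have [U [a Ua]] := hermitian_diagonalization (lincomb_hermitian mu).
exact: (Re_tr_expmx_gt0 Ua).
Qed.

Lemma derive_logZ mu i : derive (logZ F) mu (evec R i) = Zof (F i) mu / Z mu.
Proof.
apply: (@derive_val _ _ _ _ _ _ _ _); apply/is_derive_line.
have /is_derive_line dZ := is_derive_Z mu i.
have dln : is_derive (Z ((0 : R) *: evec R i + mu)) (1 : R) (@ln R) (Z mu)^-1.
  by rewrite scale0r add0r; apply: is_derive1_ln; exact: Z_gt0.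
rewrite [_ / _]mulrC.
exact: (@is_derive1_comp R (@ln R) (fun h => Z (h *: evec R i + mu)) 0 _ _ dln dZ).
Qed.

(** The quotient rule for [Zof (F j) / Z] in direction [i]: the numerator yields the
    divided-difference sum, the denominator the product of means. *)
Lemma hessian_logZE U a lam i j : unitary_diag U a (lincomb F lam) ->
  hessian_logZ F lam i j = exp_deriv_tr U a (F i) (F j) / Z lam -
    (Zof (F i) lam / Z lam) * (Zof (F j) lam / Z lam).
Proof.
move=> Ua; rewrite mxE.
have -> : (fun mu => derive (logZ F) mu (evec R j)) =
          (fun mu => Zof (F j) mu * (Z mu)^-1).
  by apply/funext => mu; rewrite derive_logZ.
have Z0 := Z_gt0 lam.
apply: (@derive_val _ _ _ _ _ _ _ _); apply/is_derive_line.
have /is_derive_line dZ := is_derive_Z lam i.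
have /is_derive_line dZj := is_derive_Zof (F j) i Ua.
have Zl : Z ((0 : R) *: evec R i + lam) = Z lam by rewrite scale0r add0r.
have Zn0 : Z ((0 : R) *: evec R i + lam) != 0 by rewrite Zl gt_eqF.
have dV := is_deriveV Zn0 dZ.
have dM := is_deriveM dZj dV.
apply: is_derive_eq dM _.
rewrite scale0r add0r /GRing.scale /=; field.
by rewrite gt_eqF.
Qed.

End LogPartition.

(** * The Hessian against the diagonal of means *)

Theorem theorem4p3 (R : realType) (d k : nat) (F : 'I_k -> 'M[complex R]_d)
  (lam : 'rV[R]_k) :
  (forall j, psdmx (F j)) ->
  loewner_le (\sum_(j < k) F j) 1%:M ->
  loewner_le (map_mx (@rC R) (hessian_logZ F lam)) (meanmx F lam).
Proof.
move=> psdF sumF.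
(* For [d = 0] every trace is zero, so [Z] is not positive; there the Hessian and the matrix of
   means both vanish. *)
have [d0|d_gt0] := posnP d.
  subst d; rewrite /loewner_le.
  have tr0 (M : 'M[complex R]_0) : \tr M = 0 by rewrite /mxtrace big_ord0.
  have -> : meanmx F lam = 0.
    by apply/matrixP=> i j; rewrite !mxE tr0 if_same.
  have -> : hessian_logZ F lam = 0.
    apply/matrixP=> i j; rewrite !mxE.
    have -> : logZ F = cst (ln 0) by apply/funext => mu; rewrite /logZ tr0.
    under eq_fun do rewrite derive_cst.
    exact: derive_cst.
  by rewrite map_mx0 subr0; exact: psdmx0.
pose A := lincomb F lam.
have [U [a Ua]] := hermitian_diagonalization (lincomb_hermitian psdF lam).
pose Z : R := complex.Re (\tr (expmx A)).
pose m i : R := complex.Re (\tr (expmx A *m F i)) / Z.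
pose K i j := exp_deriv_tr U a (F i) (F j).
have Z0 : 0 < Z by exact: Z_gt0.
(* The entries of [P - L] are real, so [psdmx_map_rC] reduces the claim to real vectors. *)
pose M : 'M[R]_k :=
  \matrix_(i, j) ((if i == j then m i else 0) - (K i j / Z - m i * m j)).
rewrite /loewner_le.
have -> : meanmx F lam - map_mx (@rC R) (hessian_logZ F lam) = map_mx (@rC R) M.
  apply/matrixP=> i j; rewrite [LHS]mxE [RHS]mxE [M _ _]mxE rmorphB.
  rewrite [X in X + _ = _]mxE [X in _ + X = _]mxE [X in _ - X = _]mxE.
  rewrite (hessian_logZE psdF d_gt0 i j Ua); congr (_ - _).
  case: ifP => [_|//].
  (* Both traces are real, so the complex quotient is the image of [m i]. *)
  rewrite /gibbs -scalemxAr mxtraceZ mxtrace_mulC -/A (tr_expmx_real Ua (psdF i).1).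
  rewrite -{1}[expmx A]mulmx1 (tr_expmx_real Ua (adjmx1 _ _)) mulmx1.
  by rewrite mulrC -fmorphV -rmorphM.
apply: psdmx_map_rC.
  have KC i j : K i j = K j i by exact: exp_deriv_trC.
  apply/matrixP=> i j; rewrite mxE [LHS]mxE [RHS]mxE KC [m j * m i]mulrC.
  by have [->|_] := eqVneq i j.
move=> x.
pose X := \sum_j rC (x j) *: F j.
have hX : adjmx X = X.
  by rewrite adjmx_sum; apply: eq_bigr => j _; rewrite adjmxZ (psdF j).1.
(* Bilinearity collects the quadratic form of [K] at [x] into a single value at [X]. *)
have KX : exp_deriv_tr U a X X = \sum_i \sum_j x i * x j * K i j.
  rewrite exp_deriv_tr_suml; apply: eq_bigr => i _.
  rewrite exp_deriv_trC exp_deriv_tr_suml mulr_sumr; apply: eq_bigr => j _.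
  by rewrite mulrA exp_deriv_trC.
have := exp_deriv_tr_le Ua hX; rewrite KX => KXle.
(* Pairing [exp A] with [sum_j x_j^2 F_j - X^2] gives, with [KXle],
   [K(X, X) <= Z sum_j x_j^2 m_j]. *)
have := Re_tr_expmx_psd_ge0 Ua (sqr_sum_loewner x psdF sumF).
rewrite mulmxBr linearB /= Re_sub subr_ge0 => /(le_trans KXle).
have -> : complex.Re (\tr (expmx A *m \sum_j rC (x j ^+ 2) *: F j)) =
    (\sum_j x j ^+ 2 * m j) * Z.
  rewrite mulmx_sumr [\tr _]raddf_sum Re_sum mulr_suml; apply: eq_bigr => j _.
  by rewrite -scalemxAr /= mxtraceZ Re_rCM /m -!mulrA mulVf ?mulr1 // gt_eqF.
rewrite -ler_pdivrMr // => KZ.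
(* The rank-one part of the Hessian enters [P - L] with a plus sign, as the square of
   [sum_i x_i m_i]. *)
have -> : \sum_i \sum_j x i * x j * M i j =
    \sum_j x j ^+ 2 * m j - (\sum_i \sum_j x i * x j * K i j) / Z +
    (\sum_i x i * m i) ^+ 2.
  rewrite expr2 !mulr_suml -sumrB -big_split; apply: eq_bigr => i _ /=.
  rewrite mulr_sumr mulr_suml.
  have -> : x i ^+ 2 * m i = \sum_j x i * x j * (if i == j then m i else 0).
    rewrite (bigD1 i) //= eqxx big1 ?addr0 ?expr2 // => j ji.
    by rewrite eq_sym (negPf ji) mulr0.
  rewrite -sumrB -big_split; apply: eq_bigr => j _ /=. rewrite [M _ _]mxE.
  have distr (u v e K' m1 m2 : R) : u * v * (e - (K' / Z - m1 * m2)) =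
      u * v * e - u * v * K' / Z + u * m1 * (v * m2) by ring.
  exact: distr.
by rewrite addr_ge0 ?sqr_ge0 // subr_ge0.
Qed.
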